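(* Let $\mathcal X$ be a locally convex ordered topological vector space. Let $\mathcal A\subset\mathcal X$ be a closed, convex acceptance set and $S=(S_0,S_T)$ a traded asset with pricing functional $\pi$. If $\rho_{\mathcal A,S}$ is continuous at an interior point $X$ of its domain of finiteness, then $$\rho_{\mathcal A,S,\pi}(X)=\max_{\psi\in\mathcal X'_{+,S}}\left\{\pi\left(\frac{\psi(-X)-\rho^\ast_{\mathcal A,S}(-\psi)}{S_0}\right)\right\},$$ where the maximum is attained.
   Context: An ordered topological vector space $\mathcal X$ is a Hausdorff real topological vector space ordered by a pointed convex cone $\mathcal X_+$ ($\mathcal X_+\cap(-\mathcal X_+)=\{0\}$); $X\le Y$ means $Y-X\in\mathcal X_+$. $\mathcal X'$ is the topological dual and $\mathcal X'_+=\{\psi\in\mathcal X' : \psi(X)\ge0\text{ for all }X\in\mathcal X_+\}$. An acceptance set is a nonempty proper subset $\mathcal A\subset\mathcal X$ such that $X\in\mathcal A$ and $Y\ge X$ imply $Y\in\mathcal A$. A traded asset is a pair $S=(S_0,S_T)$ with $S_0>0$ real and $S_T\in\mathcal X_+$ nonzero. A pricing functional for $S$ is a strictly increasing function $\pi:\mathbb R\to\mathbb R$ (not necessarily continuous) with $\pi(0)=0$ and $\pi(1)=S_0$; set $\pi(\pm\infty)=\lim_{\lambda\to\pm\infty}\pi(\lambda)$. Define, with $\inf\emptyset=\infty$, $$\rho_{\mathcal A,S}(X)=\inf\{m\in\mathbb R : X+\tfrac{m}{S_0}S_T\in\mathcal A\},\qquad \rho_{\mathcal A,S,\pi}(X)=\inf\{\pi(\lambda)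 : \lambda\in\mathbb R,\ X+\lambda S_T\in\mathcal A\}.$$ The domain of finiteness of $\rho_{\mathcal A,S}$ is the set where it takes real values. The Fenchel conjugate of $\rho:\mathcal X\to\mathbb R\cup\{\pm\infty\}$ is $\rho^\ast(\psi)=\sup_{X\in\mathcal X}\{\psi(X)-\rho(X)\}$ for $\psi\in\mathcal X'$. Finally $\mathcal X'_{+,S}=\{\psi\in\mathcal X'_+ : \psi(S_T)=S_0\}$. *)

(* Defs.v *)
From mathcomp Require Import all_boot all_order all_algebra.
From mathcomp Require Import all_classical all_reals all_analysis.

Set Implicit Arguments.
Unset Strict Implicit.
Unset Printing Implicit Defensive.

Import Order.TTheory GRing.Theory Num.Theory.
Import numFieldNormedType.Exports.

Local Open Scope classical_set_scope.
Local Open Scope ring_scope.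

Section RiskMeasures.
Context {R : realType} {E : tvsType R}.
Implicit Types (P A : set E) (S : R * E) (pi : R -> R) (psi : E -> R).

(* That 0 belongs to P is part of the third clause. *)
Definition pointed_convex_cone P : Prop :=
  [/\ (forall (t : R) X, 0 <= t -> P X -> P (t *: X)),
      @convex_set R E P
    & P `&` [set - X | X in P] = [set 0]].

Definition cone_le P (X Y : E) : Prop := P (Y - X).

Definition acceptance_set P A : Prop :=
  [/\ A !=set0, A != setT & forall X Y, A X -> cone_le P X Y -> A Y].

(* S = (S_0, S_T). *)
Definition traded_asset P S : Prop :=
  [/\ 0 < S.1, P S.2 & S.2 != 0].

Definition pricing_functional S pi : Prop :=
  [/\ {homo pi : x y / x < y}, pi 0 = 0 & pi 1 = S.1].

Definition pricing_ext pi (x : \bar R) : \bar R :=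
  match x with
  | r%:E => (pi r)%:E
  | +oo%E => lim ((pi l)%:E @[l --> +oo])
  | -oo%E => lim ((pi l)%:E @[l --> -oo])
  end.

(* The infimum of the empty set is +oo. *)
Definition risk_measure A S (X : E) : \bar R :=
  ereal_inf [set m%:E | m in [set m : R | A (X + (m / S.1) *: S.2)]].

Definition priced_risk_measure A S pi (X : E) : \bar R :=
  ereal_inf [set (pi l)%:E | l in [set l : R | A (X + l *: S.2)]].

Definition finiteness_domain (rho : E -> \bar R) : set E :=
  [set X | rho X \is a fin_num].

Definition topological_dual : set (E -> R) :=
  [set psi : E -> R | scalar psi /\ continuous psi].

Definition dual_cone P : set (E -> R) :=
  [set psi : E -> R | topological_dual psi /\ forall X, P X -> 0 <= psi X].

Definition dual_cone_normalized P S : set (E -> R) :=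
  [set psi : E -> R | dual_cone P psi /\ psi S.2 = S.1].

(* Only meaningful for psi in the topological dual. *)
Definition fenchel_conjugate (rho : E -> \bar R) psi : \bar R :=
  ereal_sup [set ((psi X)%:E - rho X)%E | X in setT].

End RiskMeasures.

Definition is_maximum {R : realType} (V : set (\bar R)) (m : \bar R) : Prop :=
  V m /\ ubound V m.

(* Main.v *)
(** Along the line [X + l S_T] the acceptance set is a half-line [l >= l0], so
    the priced risk measure at [X] is [pi l0] with [l0 = rho X / S_0].
    Monotonicity of [pi] and the Fenchel inequality at [X] bound every dual value
    by [pi l0].  The bound is attained at a negated subgradient of [rho] at [X]:
    the slopes [s] for which [W + s S_T] points into [A] from the boundary point
    [X + l0 S_T] have an infimum that is sublinear in [W], a linear functional
    below it exists by Hahn-Banach, and it is continuous because [rho] is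
    bounded above near [X].  Hahn-Banach itself is obtained from a minimal
    sublinear functional, which is necessarily linear. *)

Require Import Defs.
From mathcomp Require Import all_boot all_order all_algebra.
From mathcomp Require Import all_classical all_reals all_analysis.
From mathcomp Require Import ring lra.

Set Implicit Arguments.
Unset Strict Implicit.
Unset Printing Implicit Defensive.

Import Order.TTheory GRing.Theory Num.Theory.
Import numFieldNormedType.Exports.

Local Open Scope classical_set_scope.
Local Open Scope ring_scope.

(** * Sublinear functionals and the Hahn-Banach theorem *)

Section Sublinear.
Context {R : realType} {V : lmodType R}.
Implicit Types (p q : V -> R) (x y : V).

(** Homogeneity is asked only as an inequality, the form in which infima deliver it; applying it to
    [t] and to [t^-1] recovers equality for [t > 0]. *)
Definition sublinear p : Prop :=
  (forall x y, p (x + y) <= p x + p y) /\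
  (forall (t : R) x, 0 <= t -> p (t *: x) <= t * p x).

Lemma sublinear0 p : sublinear p -> p 0 = 0.
Proof.
move=> [pD pZ]; apply/eqP; rewrite eq_le; apply/andP; split.
  by have := pZ 0 0 (lexx _); rewrite scale0r mul0r.
by have := pD 0 0; rewrite addr0 -subr_ge0 addrK.
Qed.

Lemma sublinearN p x : sublinear p -> - p (- x) <= p x.
Proof.
move=> sp; have := sp.1 x (- x); rewrite subrr (sublinear0 sp); lra.
Qed.

Lemma sublinearZ p (t : R) x : sublinear p -> 0 <= t -> p (t *: x) = t * p x.
Proof.
move=> sp; rewrite le_eqVlt => /predU1P[<-|t0].
  by rewrite scale0r mul0r sublinear0.
apply/eqP; rewrite eq_le (sp.2 _ _ (ltW t0))/= -ler_pdivlMl//.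
have := sp.2 t^-1 (t *: x); rewrite scalerA mulVf ?gt_eqF// scale1r; apply.
by rewrite invr_ge0 ltW.
Qed.

(** Common source of three infima: over a chain of functionals, along a direction, and over tangent
    slopes. Domination by [c] replaces equality because, in a chain, two values may come from
    different functionals and are added only after passing to the smaller one. *)
Lemma sublinear_inf (F : V -> set R) :
  (forall x, F x !=set0) -> (forall x, has_lbound (F x)) ->
  (forall x y a b, F x a -> F y b -> exists2 c, F (x + y) c & c <= a + b) ->
  (forall (t : R) x a, 0 <= t -> F x a ->
    exists2 c, F (t *: x) c & c <= t * a) ->
  sublinear (fun x => inf (F x)).
Proof.
move=> F0 Flb FD FZ.
have infF x a : F x a -> inf (F x) <= a by move=> Fa; exact: ge_inf.
split=> [x y|t x].
  rewrite -lerBlDl; apply: lb_le_inf => // b Fb; rewrite lerBlDl -lerBlDr.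
  apply: lb_le_inf => // a Fa; rewrite lerBlDr.
  by have [c Fc cab] := FD _ _ _ _ Fa Fb; apply: le_trans cab; exact: infF.
rewrite le_eqVlt => /predU1P[<-|t0].
  have [a Fa] := F0 x; have [c Fc] := FZ 0 x a (lexx 0) Fa.
  by rewrite !mul0r; apply: le_trans; exact: infF.
rewrite -ler_pdivrMl//; apply: lb_le_inf => // a Fa; rewrite ler_pdivrMl//.
by have [c Fc cta] := FZ _ _ _ (ltW t0) Fa; apply: le_trans cta; exact: infF.
Qed.

(** Zorn's lemma for the reversed pointwise order: the pointwise infimum of a nonempty chain is
    again sublinear, and [p] itself bounds the empty chain. *)
Lemma minimal_sublinear p : sublinear p ->
  exists q, [/\ sublinear q, forall x, q x <= p x &
    forall r, sublinear r -> (forall x, r x <= q x) -> r = q].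
Proof.
move=> sp; pose T := {q : V -> R | sublinear q /\ forall x, q x <= p x}.
pose le_T (q r : T) := `[< forall x, sval r x <= sval q x >].
have [|||C Ctot|[q [sq qp]] qmin] := @Zorn T le_T.
- by move=> q; apply/asboolP => x.
- move=> q r s /asboolP qr /asboolP rs; apply/asboolP => x.
  exact: le_trans (rs x) (qr x).
- move=> q r /asboolP qr /asboolP rq; apply: eq_sig_hprop => [h a b|].
    exact: Prop_irrelevance.
  apply/funext => x.
  by apply/eqP; rewrite eq_le qr rq.
- have [->|/set0P[q0 Cq0]] := eqVneq C set0.
    by exists (exist _ p (conj sp (fun x => lexx (p x)))) => ?.
  pose F x := [set sval q x | q in C].
  have Flb x : has_lbound (F x).
    (* Uniform over the chain: [- p (- x) <= - q (- x) <= q x]. *)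
    exists (- p (- x)) => _ [[q [sq qp]] _ <-] /=.
    by apply: le_trans (sublinearN x sq); rewrite lerN2.
  have sF : sublinear (fun x => inf (F x)).
    apply: sublinear_inf => //.
    + by move=> x; exists (sval q0 x), q0.
    + move=> x y _ _ [q Cq <-] [r Cr <-].
      have [[sq _] [sr _]] := (svalP q, svalP r).
      have [/asboolP qr|/asboolP rq] := Ctot _ _ Cq Cr.
        exists (sval r (x + y)); first by exists r.
        by apply: le_trans (sr.1 _ _) _; rewrite lerD2r.
      exists (sval q (x + y)); first by exists q.
      by apply: le_trans (sq.1 _ _) _; rewrite lerD2l.
    + move=> t x _ t0 [q Cq <-]; exists (sval q (t *: x)); first by exists q.
      exact: (svalP q).1.2.
  have Fle (q : T) x : C q -> inf (F x) <= sval q x.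
    by move=> Cq; apply: ge_inf => //; exists q.
  have Fp x : inf (F x) <= p x.
      by apply: le_trans (Fle _ x Cq0) _; exact: (svalP q0).2.
  exists (exist _ (fun x => inf (F x)) (conj sF Fp)) => q Cq.
  by apply/asboolP => x; exact: Fle.
exists q; split=> // r sr rq.
have rp x : r x <= p x by exact: le_trans (rq x) (qp x).
have qr : le_T (exist _ q (conj sq qp)) (exist _ r (conj sr rp)).
  exact/asboolP.
by case: (qmin _ qr).
Qed.

Lemma minimal_sublinear_scalar q : sublinear q ->
  (forall r, sublinear r -> (forall x, r x <= q x) -> r = q) -> scalar q.
Proof.
move=> sq qmin.
have qD x y : q (x + y) = q x + q y.
  (* The infimum of the slopes of [q] along the direction [y] is a sublinear
     functional below [q]; minimality makes it equal to [q]. *)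
  pose F z := [set q (z + t *: y) - t * q y | t in [set t : R | 0 <= t]].
  have Flb z : has_lbound (F z).
    exists (- q (- z)) => _ [t /= t0 <-]; rewrite -sublinearZ//.
    by have := sq.1 (z + t *: y) (- z); rewrite addrAC subrr add0r; lra.
  have F1 z : F z (q z) by exists 0 => //=; rewrite scale0r addr0 mul0r subr0.
  have sF : sublinear (fun z => inf (F z)).
    apply: sublinear_inf => //.
    + by move=> z; exists (q z).
    + move=> z w _ _ [t /= t0 <-] [s /= s0 <-].
      exists (q ((z + w) + (t + s) *: y) - (t + s) * q y).
        by exists (t + s) => //=; exact: addr_ge0.
      have := sq.1 (z + t *: y) (w + s *: y).
      by rewrite addrACA -scalerDl mulrDl; lra.
    + move=> s z _ s0 [t /= t0 <-].
      exists (q (s *: z + (s * t) *: y) - (s * t) * q y).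
        by exists (s * t) => //=; exact: mulr_ge0.
      by rewrite -scalerA -scalerDr mulrBr mulrA lerD2r; exact: sq.2.
  have Fq : (fun z => inf (F z)) = q.
    by apply: qmin => // z; exact: ge_inf.
  (* Superadditivity is the member [t = 1] of [F x]: the infimum, equal to [q x], is at most
     [q (x + y) - q y]. *)
  apply/eqP; rewrite eq_le sq.1/= -[q x](congr1 (@^~ x) Fq)/= -lerBrDr.
  apply: ge_inf => //; exists 1; first exact: ler01.
  by rewrite scale1r mul1r.
have qN x : q (- x) = - q x.
  by apply/eqP; rewrite -addr_eq0 -qD addrC subrr sublinear0.
move=> a x y; rewrite qD; congr (_ + _).
have [a0|a0] := leP 0 a; first exact: sublinearZ.
have := @sublinearZ q (- a) x sq; rewrite scaleNr qN oppr_ge0 ltW// => /(_ isT).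
by rewrite mulNr => /oppr_inj.
Qed.

Theorem hahn_banach_sublinear p : sublinear p ->
  exists2 f : V -> R, scalar f & forall x, f x <= p x.
Proof.
move=> /minimal_sublinear[q [sq qp qmin]]; exists q => //.
exact: minimal_sublinear_scalar.
Qed.

End Sublinear.

(** * Algebra of linear forms *)

Section LinearForm.
Context {R : realType} {V : lmodType R} (f : V -> R) (fl : scalar f).

Lemma linear_formD x y : f (x + y) = f x + f y.
Proof. by have := fl 1 x y; rewrite scale1r mul1r. Qed.

Lemma linear_form0 : f 0 = 0.
Proof. by have := linear_formD 0 0; rewrite addr0; lra. Qed.

Lemma linear_formZ (a : R) x : f (a *: x) = a * f x.
Proof. by have := fl a x 0; rewrite !addr0 linear_form0 addr0. Qed.

Lemma linear_formN x : f (- x) = - f x.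
Proof. by rewrite -scaleN1r linear_formZ mulN1r. Qed.

End LinearForm.

(** * Continuity in topological vector spaces *)

Section TopologicalVector.
Context {R : realType} {E : tvsType R}.
Implicit Types (x y z : E).

Lemma dilation_continuous (k : R) z : continuous (fun x => k *: (x - z)).
Proof.
move=> x; have cB : (y - z) @[y --> x] --> x - z.
  apply: (@continuous2_cvg E E E E (nbhs x) _ _ _ (fun u v => u - v)).
  - exact: (@sub_continuous E (x, z)).
  - exact: cvg_id.
  - exact: cvg_cst.
apply: (@continuous2_cvg E R^o E E (nbhs x) _ _ _ (fun a u => a *: u)).
- exact: (@scale_continuous R E (k, x - z)).
- exact: cvg_cst.
- exact: cB.
Qed.

Lemma line_continuous x z : continuous (fun l : R^o => x + l *: z).
Proof.
move=> l; have cZ : (m *: z) @[m --> (l : R^o)] --> l *: z.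
  apply: (@continuous2_cvg R^o R^o E E (nbhs l) _ _ _ (fun a u => a *: u)).
  - exact: (@scale_continuous R E (l, z)).
  - exact: cvg_id.
  - exact: cvg_cst.
apply: (@continuous2_cvg R^o E E E (nbhs l) _ _ _ (fun u v => u + v)).
- exact: (@add_continuous E (x, l *: z)).
- exact: cvg_cst.
- exact: cZ.
Qed.

(** A one-sided bound suffices: applied to both [k *: (y - x)] and its opposite, it bounds
    [k * (f y - f x)] in absolute value. *)
Lemma scalar_ubounded_continuous (f : E -> R) (M : R) :
  scalar f -> (\forall x \near (0 : E), f x <= M) -> continuous f.
Proof.
move=> fl fM x; apply/cvgrPdist_lt => e e0.
have M0 : 0 < `|M| + 1 by rewrite ltr_wpDl.
(* Chosen so that a bound [|M| + 1] on the dilated increment becomes [e] on [f y - f x]; the added 1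
   makes the bound positive and strict. *)
pose k := (`|M| + 1) / e.
have k0 : 0 < k by exact: divr_gt0.
have near0 (c : R) : \forall y \near x, f (c *: (y - x)) <= M.
  have := @dilation_continuous c x x.
  by rewrite /continuous_at subrr scaler0 => /(_ _ fM).
near=> y.
have : f (k *: (y - x)) <= M by near: y; exact: near0.
have : f (- k *: (y - x)) <= M by near: y; exact: near0.
rewrite !(linear_formZ fl) (linear_formD fl) (linear_formN fl) mulNr => fN fP.
have : `|k * (f y - f x)| < `|M| + 1.
  rewrite ltr_norml; have := ler_norm M; lra.
by rewrite normrM gtr0_norm// -ltr_pdivlMl// distrC /k
  invf_div mulrVK ?unitfE ?gt_eqF.
Unshelve. all: by end_near. Qed.

End TopologicalVector.

(** * Tangent slopes of a convex set *)

Section TangentSlopes.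
Context {R : realType} {E : tvsType R}.

(** For convex [A], the infimum of these slopes is the directional derivative at [X] along [W] of
    the function sending [Y] to the infimum of all [s] with [Y + s *: Z] in [A], provided that
    function vanishes at [X]. *)
Definition tangent_slopes (A : set E) (X Z W : E) : set R :=
  [set s | exists2 t : R, 0 < t & A (X + t *: (W + s *: Z))].

Lemma convex_set_conv (A : set E) (X Y : E) (a : R) : @convex_set R E A ->
  0 <= a -> a <= 1 -> A X -> A Y -> A (a *: X + (1 - a) *: Y).
Proof.
move=> Acvx a0 a1 AX AY.
have a01 : Itv.spec (@Itv.num_sem R) (Itv.Real `[0%Z, 1%Z]) a.
  by rewrite /Itv.spec/= /Itv.num_sem/= num_real in_itv/= a0.
have := Acvx X Y (Itv.mk a01); rewrite !inE => /(_ AX AY); exact.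
Qed.

Context (A : set E) (X Z : E) (Acvx : @convex_set R E A).

Lemma tangent_slopesD W W' a b : tangent_slopes A X Z W a ->
  tangent_slopes A X Z W' b -> tangent_slopes A X Z (W + W') (a + b).
Proof.
move=> [t t0 At] [u u0 Au]; have tu0 : 0 < t + u by exact: addr_gt0.
(* The weights [u / (t + u)] and [t / (t + u)] give both displacements the same coefficient in the
   convex combination. *)
exists (t * u / (t + u)); first by rewrite divr_gt0// mulr_gt0.
have h0 : 0 <= u / (t + u) by rewrite divr_ge0 ?ltW.
have h1 : u / (t + u) <= 1 by rewrite ler_pdivrMr// mul1r lerDr ltW.
have := convex_set_conv Acvx h0 h1 At Au.
have -> : 1 - u / (t + u) = t / (t + u) by field; rewrite gt_eqF.
congr (A _).
have -> : W + W' + (a + b) *: Z = (W + a *: Z) + (W' + b *: Z).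
  by rewrite scalerDl addrACA.
rewrite !scalerDr !scalerA addrACA -scalerDl -[X in _ = X + _]scale1r.
congr (_ *: _ + (_ *: _ + _ *: _ + (_ *: _ + _ *: _))); field;
  by rewrite gt_eqF.
Qed.

Lemma tangent_slopesZ (t : R) W a : 0 < t ->
  tangent_slopes A X Z W a -> tangent_slopes A X Z (t *: W) (t * a).
Proof.
move=> t0 [u u0 Au]; exists (u / t); first exact: divr_gt0.
by rewrite -(scalerA t a) -scalerDr scalerA divfK ?gt_eqF.
Qed.

Hypothesis Age0 : forall s, A (X + s *: Z) -> 0 <= s.
Hypothesis A0 : forall W, tangent_slopes A X Z W !=set0.

(** A slope for [W] plus a slope for [- W] is a slope for 0, hence nonnegative by [Age0]. *)
Lemma tangent_slopes_lbound W : has_lbound (tangent_slopes A X Z W).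
Proof.
have [b Fb] := A0 (- W); exists (- b) => a Fa.
have [t t0] := tangent_slopesD Fa Fb; rewrite subrr add0r scalerA => /Age0.
by rewrite pmulr_rge0//; lra.
Qed.

Lemma tangent_slopes_sublinear : A X ->
  sublinear (fun W => inf (tangent_slopes A X Z W)).
Proof.
move=> AX; apply: sublinear_inf => //.
- exact: tangent_slopes_lbound.
- by move=> W W' a b Fa Fb; exists (a + b) => //; exact: tangent_slopesD.
- move=> t W a; rewrite le_eqVlt => /predU1P[<- _|t0 Fa].
    (* The zero direction has slope 0 because [X] itself lies in [A]. *)
    exists 0; last by rewrite mul0r.
    by exists 1 => //; rewrite !scale0r !addr0 scaler0 addr0.
  by exists (t * a) => //; exact: tangent_slopesZ.
Qed.

End TangentSlopes.

(** * Monotonicity of the extended pricing functional *)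

Lemma nondecreasing_is_cvgeNy (R : realType) (f : R -> \bar R) :
  nondecreasing_fun f -> cvg (f x @[x --> -oo]).
Proof.
move=> f_nd; apply/cvg_ex; exists (ereal_inf (range (f \o -%R))).
apply/cvgNy_compNP; apply: nonincreasing_cvge => x y xy.
by apply: f_nd; rewrite lerN2.
Qed.

Lemma pricing_ext_le (R : realType) (pi : R -> R) (c : \bar R) (r : R) :
  {homo pi : x y / x < y} -> (c <= r%:E)%E ->
  (pricing_ext pi c <= (pi r)%:E)%E.
Proof.
move=> /ltW_homo pi_nd; case: c => [c| |] //=.
  by rewrite !lee_fin; exact: pi_nd.
(* Only [c = -oo] remains: the limit of [pi] at [-oo] lies below every value of [pi]. *)
move=> _; apply: lime_le.
  by apply: nondecreasing_is_cvgeNy => x y xy; rewrite lee_fin; exact: pi_nd.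
near=> l; rewrite lee_fin; apply: pi_nd.
by near: l; apply: nbhs_ninfty_le; rewrite num_real.
Unshelve. all: by end_near. Qed.

(** * Acceptance along the traded asset and subgradients of the risk measure *)

Section Acceptance.
Context {R : realType} {E : tvsType R} (P : set E) (A : set E) (S : R * E).
Hypotheses (hP : pointed_convex_cone P) (hA : acceptance_set P A).
Hypotheses (Acl : closed A) (Acvx : @convex_set R E A) (hS : traded_asset P S).

Lemma acceptance_up (Y : E) (l k : R) :
  l <= k -> A (Y + l *: S.2) -> A (Y + k *: S.2).
Proof.
have [_ _ Aup] := hA; move=> lk Al; apply: Aup Al _.
rewrite /cone_le opprD addrACA subrr add0r -scalerBl.
by case: hP => PZ _ _; apply: PZ; [rewrite subr_ge0|case: hS].
Qed.

Variables (X : E) (r0 : R).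
Hypothesis rX : risk_measure A S X = r0%:E.

Lemma acceptance_levels (l : R) : A (X + l *: S.2) <-> r0 / S.1 <= l.
Proof.
have [S0 _ _] := hS; split => [Al|r0l].
  rewrite ler_pdivrMr// -lee_fin -rX; apply: ereal_inf_lbound.
  by exists (l * S.1) => //=; rewrite mulfK ?gt_eqF.
apply: (acceptance_up r0l); set l0 := r0 / S.1.
(* Every level [k > l0] is accepted, so closedness of [A] gives acceptance at [l0] when [k]
   decreases to it. *)
apply: (@closed_cvg _ _ (l0^'+) _ (fun k => X + k *: S.2) A Acl); last first.
  by apply: cvg_at_right_filter; exact: (@line_continuous R E X S.2 l0).
near=> k; have lk : l0 < k by near: k; exact: nbhs_right_gt.
have : (risk_measure A S X < (k * S.1)%:E)%E.
  by rewrite rX lte_fin -ltr_pdivrMr.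
move=> /ereal_inf_lt[_ [m /= Am <-]]; rewrite lte_fin => mk.
by apply: acceptance_up Am; rewrite ler_pdivrMr// ltW.
Unshelve. all: by end_near. Qed.

(* Cash additivity makes a linear functional [f] dominated by the tangent
   slopes at [X + (r0 / S.1) *: S.2] satisfy [f S.2 = -1], and [S.1 * f] is then a
   subgradient of the risk measure at [X]; [psi] is its opposite. *)
Lemma risk_measure_subgradient : {for X, continuous (risk_measure A S)} ->
  exists2 psi, dual_cone_normalized P S psi &
    forall Y m, A (Y + (m / S.1) *: S.2) -> r0 + psi X - psi Y <= m.
Proof.
move=> rcont; have [S0 PS Sn0] := hS; set l0 := r0 / S.1.
set X0 := X + l0 *: S.2.
have AX0 : A X0 by exact/acceptance_levels.
have As0 s : A (X0 + s *: S.2) -> 0 <= s.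
  by rewrite -addrA -scalerDl => /acceptance_levels; rewrite lerDl.
set F := tangent_slopes A X0 S.2.
have F1 W s : A (X0 + W + s *: S.2) -> F W s.
  by exists 1 => //; rewrite scale1r addrA.
(* By continuity, [rho (X + W) < r0 + 1] for small [W]: one extra unit of cash, that is [1 / S.1]
   units of the asset, makes [X0 + W] acceptable. *)
pose M := 1 / S.1.
have nearF : \forall W \near (0 : E), F W M.
  have rlt : \forall Y \near X, (risk_measure A S Y < (r0 + 1)%:E)%E.
    apply: (rcont [set y | y < (r0 + 1)%:E]%E); rewrite rX.
    by apply: open_nbhs_nbhs; split;
      [exact: open_ereal_lt_ereal|rewrite /= lte_fin ltrDl].
  have rlt0 : \forall W \near (0 : E),
      (risk_measure A S (1 *: (W - (- X))) < (r0 + 1)%:E)%E.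
    have := @dilation_continuous R E 1 (- X) 0.
    by rewrite /continuous_at scale1r opprK add0r => /(_ _ rlt).
  apply: filterS rlt0 => W /=; rewrite scale1r opprK.
  move=> /ereal_inf_lt[_ [m /= Am <-]]; rewrite lte_fin => mr; apply/F1.
  have -> : X0 + W + M *: S.2 = W + X + ((r0 + 1) / S.1) *: S.2.
    by rewrite mulrDl scalerDl addrA /X0 [W + X]addrC (addrAC X W).
  by apply: acceptance_up Am; rewrite ler_pM2r ?invr_gt0// ltW.
(* For small [t > 0] the vector [t *: W] enters the neighbourhood above, and its slope [M] rescales
   to the slope [t^-1 * M] of [W]. *)
have F0 W : F W !=set0.
  have : \forall t \near (0 : R^o), F (0 + t *: W) M.
    have := @line_continuous R E 0 W 0.
    by rewrite /continuous_at scale0r addr0 => /(_ _ nearF).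
  move=> nearM; near (0 : R)^'+ => t.
  have t0 : 0 < t by near: t; exact: nbhs_right_gt.
  have [u u0 Au] : F (0 + t *: W) M.
    by near: t; exact: (cvg_within _ nearM).
  exists (t^-1 * M); exists (u * t); first exact: mulr_gt0.
  move: Au; rewrite add0r; congr (A (X0 + _)).
  by rewrite -(scalerA u t) (scalerDr t) (scalerA t) mulVKf ?gt_eqF.
have sp : sublinear (fun W => inf (F W)) by exact: tangent_slopes_sublinear.
have Flb W : has_lbound (F W).
  exact: tangent_slopes_lbound.
have [f fl fp] := hahn_banach_sublinear sp.
have fF W s : F W s -> f W <= s.
  by move=> Fs; apply: le_trans (fp W) _; exact: ge_inf.
have fcont : continuous f.
  apply: (@scalar_ubounded_continuous R E f M fl).
  by apply: filterS nearF => W; exact: fF.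
(* Slope -1 for [S.2] and slope 1 for [- S.2] both lead back to [X0], which lies in [A]. *)
have fS : f S.2 = -1.
  apply/eqP; rewrite eq_le; apply/andP; split.
    by apply/fF/F1; rewrite scaleN1r addrK.
  rewrite lerNl -(linear_formN fl); apply/fF/F1.
  by rewrite scale1r addrNK.
exists (fun Y => - (S.1 * f Y)).
  split; last by rewrite fS mulrN1 opprK.
  split; first split.
  - by move=> a u v; rewrite fl mulrDr opprD mulrCA -mulrN.
  - by move=> u; apply: cvgN; apply: cvgMr; exact: fcont.
  move=> W PW; rewrite oppr_ge0 pmulr_rle0//; apply/fF/F1.
  rewrite scale0r addr0; have [_ _ Aup] := hA; apply: Aup AX0 _.
  by rewrite /cone_le addrAC subrr add0r.
move=> Y m AY.
(* A unit step from [X0] in the direction [Y - X0] with slope [m / S.1] reaches the accepted point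
   [Y + (m / S.1) *: S.2]. *)
have : f (Y - X0) <= m / S.1 by apply/fF/F1; rewrite addrCA subrr addr0.
rewrite ler_pdivlMr// (linear_formD fl) (linear_formN fl) (linear_formD fl).
rewrite (linear_formZ fl) fS.
rewrite /l0; have : r0 / S.1 * S.1 = r0 by rewrite divfK ?gt_eqF.
by nra.
Unshelve. all: by end_near. Qed.

End Acceptance.

(** * The dual representation with attained maximum *)

Unset Implicit Arguments.

Theorem proposition5p11 (R : realType) (E : tvsType R) (hE : hausdorff_space E)
    (P : set E) (hP : pointed_convex_cone P)
    (A : set E) (hA : acceptance_set P A)
    (Acl : closed A) (Acvx : @convex_set R E A)
    (S : R * E) (hS : traded_asset P S)
    (pi : R -> R) (hpi : pricing_functional S pi)
    (X : E) (Xint : interior (finiteness_domain (risk_measure A S)) X)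
    (Xcont : {for X, continuous (risk_measure A S)}) :
  is_maximum
    [set pricing_ext pi
       (((psi (- X))%:E - fenchel_conjugate (risk_measure A S) (\- psi)%R)
          * (S.1^-1)%:E)%E
    | psi in dual_cone_normalized P S]
    (priced_risk_measure A S pi X).
Proof.
have [S0 _ _] := hS; have [pi_incr _ _] := hpi.
have rX : risk_measure A S X = (fine (risk_measure A S X))%:E.
  by rewrite fineK//; exact: (interior_subset Xint).
set r0 := fine _ in rX.
have -> : priced_risk_measure A S pi X = (pi (r0 / S.1))%:E.
  apply/eqP; rewrite eq_le; apply/andP; split.
    apply: ereal_inf_lbound; exists (r0 / S.1) => //=.
    exact/(acceptance_levels hP hA Acl hS rX).
  apply: le_ereal_inf_tmp => _ [l /= Al <-]; rewrite lee_fin.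
  by apply/ltW_homo/(acceptance_levels hP hA Acl hS rX).
(* Fenchel inequality at [X], the source of the upper bound for every [psi]. *)
have conj_ge psi : (((- psi X)%:E - r0%:E) <=
    fenchel_conjugate (risk_measure A S) (\- psi)%R)%E.
  by apply: ereal_sup_ubound; exists X => //; rewrite rX.
split.
  have [psi psiS psi_sub] :=
    risk_measure_subgradient hP hA Acl Acvx hS rX Xcont.
  exists psi => //; have psi_lin : scalar psi by case: psiS => -[[]].
  (* For the subgradient the Fenchel inequality is an equality, so the argument of [pi] is exactly
     [r0 / S.1]. *)
  have -> : fenchel_conjugate (risk_measure A S) (\- psi)%R =
      ((- psi X)%:E - r0%:E)%E.
    apply/eqP; rewrite eq_le conj_ge andbT.
    apply: ge_ereal_sup => _ [Y _ <-].
    have : ((r0 + psi X - psi Y)%:E <= risk_measure A S Y)%E.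
      apply: le_ereal_inf_tmp => _ [m /= Am <-].
      by rewrite lee_fin; exact: psi_sub.
    (* The value [-oo] contradicts the lower bound just proved, and [+oo] contributes [-oo] to the
       supremum. *)
    case: (risk_measure A S Y) => [m| |] //=; rewrite ?leNye//.
    by rewrite -!EFinB !lee_fin; lra.
  rewrite -!EFinB -EFinM /= (linear_formN psi_lin); congr (pi (_ * _))%:E.
  by ring.
move=> _ [psi [[[psi_lin _] _] _] <-]; apply: pricing_ext_le => //.
have := conj_ge psi; rewrite (linear_formN psi_lin).
(* The conjugate cannot be [-oo] by [conj_ge]; when it is [+oo], the argument of [pricing_ext] is
   [-oo]. *)
case: (fenchel_conjugate _ _) => [c| |] //=.
  by rewrite -!EFinB -EFinM !lee_fin => ?; rewrite ler_pM2r ?invr_gt0//; lra.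
by rewrite addeC /= gt0_mulNye ?leNye// lte_fin invr_gt0.
Qed.
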